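(* For any $\operatorname{Sym}$-invariant chain $(I_n)_{n\in\mathbb{N}}$ of squarefree monomial ideals $I_n\subset R_n$, the number of $\operatorname{Sym}(n)$-orbits whose union gives the minimal generators of the Alexander dual $I_n^\vee$ grows eventually polynomially in $n$. Moreover, the least degree of a minimal generator of $I_n^\vee$ is given by a linear function $d$ in $n$ if $n\gg 0$. The number of $\operatorname{Sym}(n)$-orbits of monomials whose union is the set of degree $d(n)$ generators of $I_n^\vee$ is given by a polynomial in $n$.
   Context: $\mathbb{N}$ denotes the positive integers. Fix $c\in\mathbb{N}$ and a field $\mathbf{k}$. For $n\in\mathbb{N}$ let $R_n=\mathbf{k}[x_{i,j}\mid i\in[c],\ j\in[n]]$, so $R_m\subseteq R_n$ for $m\le n$. The symmetric group $\operatorname{Sym}(n)$ acts on $R_n$ by $\sigma\cdot x_{i,j}=x_{i,\sigma(j)}$. A $\operatorname{Sym}$-invariant chain is a sequence $(I_n)_{n\in\mathbb{N}}$ of ideals $I_n\subseteq R_n$ with $\sigma(f)\in I_n$ for all $m\le n$, $f\in I_m$, $\sigma\in\operatorname{Sym}(n)$. For a monomial $\mathbf{m}$, let $P_{\mathbf{m}}$ be the prime ideal generated by the variables dividing $\mathbf{m}$. The Alexander dual of a squarefree monomial ideal $I$ is $I^\vee=\langle \mathbf{m}\mid P_{\mathbf{m}}\in\operatorname{Ass}(I)\rangle$, where $\operatorname{Ass}(I)$ is the set of associated primes of $I$. The minimal generators of a monomial ideal are the elements of its unique minimal generating set consisting of monomials; $\operatorname{Sym}(n)$ permutes the minimal generators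 of $I_n^\vee$. *)

(* Defs.v *)
From mathcomp Require Import all_boot all_order all_fingroup all_algebra.
From mathcomp Require Export mpoly.

Set Implicit Arguments.
Unset Strict Implicit.
Unset Printing Implicit Defensive.

Import GRing.Theory.

Local Open Scope ring_scope.

(* Ideals are Prop-valued predicates: the boolean ones of ring_quotient would
   restrict us to ideals with decidable membership. *)
Section Ideals.
Variable A : comNzRingType.
Implicit Types (I P : A -> Prop).

Definition is_ideal I : Prop :=
  [/\ I 0, (forall f g, I f -> I g -> I (f + g)) & (forall f g, I g -> I (f * g))].

Definition ideal_gen (G : A -> Prop) : A -> Prop :=
  fun f => forall J, is_ideal J -> (forall g, G g -> J g) -> J f.

Definition is_prime_ideal P : Prop :=
  [/\ is_ideal P, ~ P 1 & forall f g, P (f * g) -> P f \/ P g].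

(* P is in Ass(I) = Ass(A/I), i.e. P is a prime of the form (I : f). *)
Definition associated_prime I P : Prop :=
  is_prime_ideal P /\ exists f, forall g, P g <-> I (g * f).

End Ideals.

Section Monomials.
Variables (k : fieldType) (N : nat).
Implicit Types (I J : {mpoly k[N]} -> Prop) (m : 'X_{1..N}).
Implicit Types (S : 'X_{1..N} -> Prop).

Definition monomial_gen S : {mpoly k[N]} -> Prop :=
  ideal_gen (fun f => exists2 m, S m & f = 'X_[m]).

Definition squarefree m : Prop := forall i, (m i <= 1)%N.

Definition squarefree_monomial_ideal I : Prop :=
  exists2 S, (forall m, S m -> squarefree m)
           & forall f, I f <-> monomial_gen S f.

(* P_m; note that (_ <= _)%MM is divisibility of monomials. *)
Definition monomial_prime m : {mpoly k[N]} -> Prop :=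
  ideal_gen (fun f => exists2 i, (U_(i) <= m)%MM & f = 'X_i).

Definition alexander_dual I : {mpoly k[N]} -> Prop :=
  monomial_gen (fun m => associated_prime I (monomial_prime m)).

Definition minimal_generating_set J S : Prop :=
  (forall f, J f <-> monomial_gen S f) /\
  forall S', (forall m, S' m -> S m) -> (forall f, J f <-> monomial_gen S' f) ->
    forall m, S m -> S' m.

Definition minimal_generator J m : Prop :=
  exists2 S, minimal_generating_set J S & S m.

Definition least_generator_degree J (d : nat) : Prop :=
  (exists2 m, minimal_generator J m & mdeg m = d) /\
  forall m, minimal_generator J m -> (d <= mdeg m)%N.

End Monomials.

(* R_n is {mpoly k[c * n]}, its variables being numbered by the bijection
   mxvec_index : 'I_c -> 'I_n -> 'I_(c * n). *)
Section Chains.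
Variables (c : nat) (k : fieldType).

Definition xvar n (i : 'I_c) (j : 'I_n) : {mpoly k[c * n]} :=
  'X_(mxvec_index i j).

(* The k-algebra morphism R_m -> R_n sending x_{i,j} to x_{i,phi j}, see
   subst_cols_xvar; the tuple lists the images of all the variables. *)
Definition subst_cols m n (phi : 'I_m -> 'I_n) (f : {mpoly k[c * m]}) :
    {mpoly k[c * n]} :=
  f \mPo [tuple mxvec (\matrix_(i < c, j < m) xvar i (phi j)) 0 l | l < c * m].

Lemma subst_cols_xvar m n (phi : 'I_m -> 'I_n) (i : 'I_c) (j : 'I_m) :
  subst_cols phi (xvar i j) = xvar i (phi j).
Proof. by rewrite /subst_cols comp_mpolyXU -tnth_nth tnth_mktuple mxvecE mxE. Qed.

Definition incl m n (le_mn : (m <= n)%N) : {mpoly k[c * m]} -> {mpoly k[c * n]} :=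
  subst_cols (widen_ord le_mn).

Definition sym_act n (s : 'S_n) : {mpoly k[c * n]} -> {mpoly k[c * n]} :=
  subst_cols s.

(* Only positive indices matter; I 0 is unconstrained. *)
Definition sym_invariant_chain (I : forall n, {mpoly k[c * n]} -> Prop) : Prop :=
  (forall n, (0 < n)%N -> is_ideal (I n)) /\
  forall m n (le_mn : (m <= n)%N) f (s : 'S_n),
    (0 < m)%N -> I m f -> I n (sym_act s (incl le_mn f)).

Definition sym_orbit n (m : 'X_{1..c * n}) : 'X_{1..c * n} -> Prop :=
  fun m' => exists s : 'S_n, sym_act s 'X_[m] = 'X_[m'].

(* M is the union of exactly r distinct Sym(n)-orbits (represented by t). *)
Definition orbit_count n (M : 'X_{1..c * n} -> Prop) (r : nat) : Prop :=
  exists t : 'I_r -> 'X_{1..c * n},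
    (forall a b, sym_orbit (t a) (t b) -> a = b) /\
    (forall m, M m <-> exists a, sym_orbit (t a) m).

End Chains.

Arguments sym_orbit {c} k {n}.
Arguments orbit_count {c} k {n}.

(* Main.v *)
Require Import Defs.
From mathcomp Require Import all_boot all_order all_fingroup all_algebra.
From mathcomp Require Import boolp zify ring.

(* The minimal generators of the dual of I_n are the squarefree monomials
   supported on the complements of the facets of the Stanley-Reisner complex of
   I_n.  Up to Sym(n), a set S of variables is determined by its profile, the
   vector counting, for each subset A of [c], the columns j in which S has
   exactly the rows of A.  The chain condition makes the profiles of nonfaces an
   upward closed subset of N^(2^c) independent of n; by Dickson's lemma,
   membership in it, hence being the profile of a facet, depends only on the
   entries truncated at some constant C.  The facet profiles of sum n therefore
   split into finitely many cells (prescribed truncation t, free coordinates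
   among those where t equals C), each counted by a binomial coefficient in n.
   The degree of a generator is a weighted sum of its profile, so its least value
   is the least of finitely many linear functions of n, and the profiles that
   attain it again form finitely many cells. *)

Set Implicit Arguments.
Unset Strict Implicit.
Unset Printing Implicit Defensive.

Import Order.TTheory GRing.Theory Num.Theory.

Local Open Scope ring_scope.

(** * Upward closed sets of vectors and counting *)

(** Each term of the subsequence is least on the tail from which it is chosen, and all later terms
    lie in that tail. *)
Lemma nondecreasing_subsequence (y : nat -> nat) :
  exists phi : nat -> nat, (forall i j, (i < j)%N -> (phi i < phi j)%N) /\
    forall i j, (i <= j)%N -> (y (phi i) <= y (phi j))%N.
Proof.
have tail_min N : exists m, (N <= m)%N /\ forall m', (N <= m')%N -> (y m <= y m')%N.
  have [|v /asboolP[m Nm <-] vmin] := @ex_minnP (fun v => `[< exists2 m, (N <= m)%N & y m = v >]).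
    by exists (y N); apply/asboolP; exists N.
  by exists m; split=> // m' Nm'; apply: vmin; apply/asboolP; exists m'.
have [g gP] := choice tail_min.
pose phi i := iter i (fun m => g m.+1) (g 0%N).
have phiS i : (phi i < phi i.+1)%N by have [] := gP (phi i).+1.
exists phi; split; first exact: homo_ltn ltn_trans phiS.
apply: (homo_leq leqnn leq_trans) => -[|i]; first by have [_] := gP 0%N; apply.
have [le h] := gP (phi i).+1; apply: h.
by apply: leq_trans (ltnW (phiS _)); apply: le.
Qed.

Section Vectors.
Variable E : finType.
Implicit Types (a b : {ffun E -> nat}) (U : {ffun E -> nat} -> Prop).

Lemma common_nondecreasing_subsequence (x : nat -> {ffun E -> nat}) (s : seq E) :
  exists phi : nat -> nat, (forall i j, (i < j)%N -> (phi i < phi j)%N) /\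
    forall e, e \in s -> forall i j, (i <= j)%N -> (x (phi i) e <= x (phi j) e)%N.
Proof.
elim: s => [|e s [phi [phi_lt phi_le]]]; first by exists id.
have [psi [psi_lt psi_le]] := nondecreasing_subsequence (fun i => x (phi i) e).
exists (phi \o psi); split=> [i j ij|e' /predU1P[->|e's] i j ij] /=.
- exact/phi_lt/psi_lt.
- exact: psi_le.
- apply: phi_le => //; move: ij; rewrite leq_eqVlt => /predU1P[->//|ij].
  exact/ltnW/psi_lt.
Qed.

Definition upclosed U := forall a b, U a -> (forall e, (a e <= b e)%N) -> U b.

Definition trunc B a : {ffun E -> nat} := [ffun e => minn (a e) B].

(* Dickson's lemma: otherwise pick a_B in U whose truncation at B is not in U;
   along a nondecreasing subsequence, a late truncation dominates the first
   term, contradiction. *)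
Lemma upclosed_trunc U : upclosed U -> exists B, forall a, U (trunc B a) <-> U a.
Proof.
move=> upU; apply: contrapT => noB.
have bad B : exists a, U a /\ ~ U (trunc B a).
  apply: contrapT => noa; apply: noB; exists B => a.
  split=> [Ut|Ua]; first by apply: upU Ut _ => e; rewrite ffunE geq_minl.
  by apply: contrapT => nUt; apply: noa; exists a.
have [x xP] := choice bad.
have [phi [phi_lt phi_le]] := common_nondecreasing_subsequence x (enum E).
have le_phi i : (i <= phi i)%N.
  by elim: i => // i IHi; apply: leq_ltn_trans IHi (phi_lt _ _ _).
(* No entry of the first term exceeds [i], and the truncation bound [phi i] is at least [i], so the
   truncated late term still dominates the first one. *)
pose i := (\sum_e x (phi 0) e)%N; have [_ nU] := xP (phi i); apply: nU.
have [U0 _] := xP (phi 0%N); apply: upU U0 _ => e.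
rewrite ffunE leq_min phi_le ?mem_enum //=; apply: leq_trans (le_phi i).
by rewrite /i (bigD1 e) //= leq_addr.
Qed.

(** * Counting the vectors of a given sum in a cell *)

Definition num_comp n (P : pred {ffun E -> nat}) : nat :=
  #|[set a : {ffun E -> 'I_n.+1} |
      (\sum_e a e == n)%N & P [ffun e => a e : nat]]|.

Definition cell (t : E -> nat) (G : {set E}) : pred {ffun E -> nat} :=
  fun a => [forall e, if e \in G then (t e <= a e)%N else a e == t e].

Lemma num_cell0 t n : (\sum_e t e < n)%N -> num_comp n (cell t set0) = 0%N.
Proof.
move=> lt; apply/eqP; rewrite cards_eq0 -subset0; apply/subsetP => a.
rewrite inE => /andP[/eqP an /forallP h]; suff e : (\sum_e t e = n)%N by rewrite e ltnn in lt.
rewrite -[RHS]an; apply: eq_bigr => e _.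
by have := h e; rewrite inE ffunE => /eqP.
Qed.

(** Stars and bars: subtracting [t] leaves arbitrary naturals on the [m.+1] coordinates of [G], with
    sum [n - \sum_e t e], which [card_ord_partitions] counts. *)
Lemma num_cell t (G : {set E}) m n : #|G| = m.+1 -> (\sum_e t e <= n)%N ->
  num_comp n (cell t G) = 'C(m + (n - \sum_e t e), m).
Proof.
move=> cG le_tn; set N := (n - _)%N; rewrite -card_ord_partitions.
have szG : size (enum G) == m.+1 by rewrite -cardE cG.
pose g := Tuple szG.
have g_inj : injective (tnth g) by apply/tuple_uniqP/enum_uniq.
have gG e : (e \in G) = [exists i, tnth g i == e].
  rewrite -mem_enum; apply/(tnthP g)/existsP => [[i ->]|[i /eqP <-]]; by exists i.
(* [F u] raises [t] by the entries of [u] along the enumeration [g] of [G]; as [g] is injective, the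
   inner sum has one term on [G] and none elsewhere. *)
pose F (u : m.+1.-tuple 'I_N.+1) e := (t e + \sum_(i | tnth g i == e) tnth u i)%N.
have sumF u : (\sum_e F u e = \sum_e t e + \sum_i tnth u i)%N.
  rewrite big_split /=; congr addn.
  by rewrite [RHS](partition_big (tnth g) predT).
pose Phi u : {ffun E -> 'I_n.+1} := [ffun e => inord (F u e)].
have PhiE (u : m.+1.-tuple 'I_N.+1) e : (\sum_(i <- u) i == N)%N -> Phi u e = F u e :> nat.
  rewrite big_tuple => /eqP uN; rewrite ffunE inordK // ltnS.
  rewrite -(subnKC le_tn) -/N -uN -sumF (bigD1 e) //=; exact: leq_addr.
have Fg u i : F u (tnth g i) = (t (tnth g i) + tnth u i)%N.
  rewrite /F (big_pred1 i) // => i'; exact: (inj_eq g_inj).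
rewrite /num_comp -(card_in_imset (f := Phi)) => [|u v]; last first.
  rewrite !inE => uN vN e; apply: eq_from_tnth => i; apply/val_inj/eqP.
  by rewrite -(eqn_add2l (t (tnth g i))) -!Fg -(PhiE _ _ uN) -(PhiE _ _ vN) e.
apply: eq_card => a; rewrite inE; apply/andP/imsetP.
  move=> [/eqP an /forallP aP].
  have le_ta e : (t e <= a e)%N.
    by have := aP e; rewrite ffunE; case: ifP => // _ /eqP ->.
  have sum_d : (\sum_e (a e - t e) = N)%N by rewrite sumnB // an.
  have ltd e : (a e - t e < N.+1)%N.
    by rewrite ltnS -sum_d (bigD1 e) //= leq_addr.
  pose u := [tuple Ordinal (ltd (tnth g i)) | i < m.+1].
  have Fa e : F u e = a e.
    have [eG|eG] := boolP (e \in G).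
      have := eG; rewrite gG => /existsP[i /eqP <-].
      by rewrite Fg tnth_mktuple subnKC.
    rewrite /F big_pred0 ?addn0.
      by have := aP e; rewrite ffunE (negbTE eG) => /eqP.
    by move=> i; apply: contraNF eG => gi; rewrite gG; apply/existsP; exists i.
  have uN : (\sum_(i <- u) i == N)%N.
    rewrite big_tuple -(eqn_add2l (\sum_e t e)) -sumF (eq_bigr (fun e => a e : nat)) //.
    by rewrite an subnKC.
  exists u; first by rewrite inE.
  by apply/ffunP => e; apply: val_inj; rewrite /= PhiE.
move=> [u]; rewrite inE => uN ->; split.
  rewrite (eq_bigr (F u)) => [|e _]; last exact: PhiE.
  have := uN; rewrite sumF big_tuple => /eqP ->; by rewrite subnKC.
apply/forallP => e; rewrite ffunE PhiE //; case: ifPn => [_|eG]; first exact: leq_addr.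
rewrite /F big_pred0 ?addn0 // => i; apply: contraNF eG => gi.
by rewrite gG; apply/existsP; exists i.
Qed.

(** * Eventually polynomial counting functions *)

Definition eventually_poly (f : nat -> nat) : Prop :=
  exists (p : {poly rat}) n0, forall n, (n0 <= n)%N -> (f n)%:R = p.[n%:R].

Lemma eventually_poly_eventually f g n0 :
  (forall n, (n0 <= n)%N -> f n = g n) -> eventually_poly g -> eventually_poly f.
Proof.
move=> fg [p [n1 gp]]; exists p, (maxn n0 n1) => n; rewrite geq_max => /andP[h0 h1].
by rewrite fg ?gp.
Qed.

Lemma eventually_poly0 : eventually_poly (fun=> 0%N).
Proof. by exists 0, 0%N => n _; rewrite horner0. Qed.

Lemma eventually_poly_sum (T : finType) (Q : pred T) (f : T -> nat -> nat) :
  (forall t, Q t -> eventually_poly (f t)) -> eventually_poly (fun n => \sum_(t | Q t) f t n)%N.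
Proof.
move=> fP.
have big_evpoly (s : seq T) : eventually_poly (fun n => \sum_(t <- s | Q t) f t n)%N.
  elim: s => [|t s [p [n0 IHs]]].
    by apply: (@eventually_poly_eventually _ _ 0%N) eventually_poly0 => n _; rewrite big_nil.
  have [Qt|nQt] := boolP (Q t).
    have [q [n1 qP]] := fP t Qt; exists (q + p), (maxn n0 n1) => n.
    rewrite geq_max => /andP[h0 h1].
    by rewrite big_cons Qt natrD hornerD IHs // qP.
  by exists p, n0 => n h; rewrite big_cons (negbTE nQt) IHs.
exact: big_evpoly.
Qed.

Lemma eventually_poly_bin m s : eventually_poly (fun n => 'C(m + (n - s), m)).
Proof.
(* The binomial is a falling factorial over [m!]; its factors are linear in [n] once [n] is at least
   [s], where the truncated subtraction is exact. *)
exists ((m`!%:R)^-1 *: \prod_(i < m) ('X + (m%:R - s%:R - i%:R)%:P)), s => n sn.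
rewrite hornerZ horner_prod; apply: (@mulfI _ m`!%:R).
  by rewrite pnatr_eq0 -lt0n fact_gt0.
rewrite mulVKf ?pnatr_eq0 -?lt0n ?fact_gt0 // mulrC -natrM bin_ffact ffact_prod natr_prod.
apply: eq_bigr => i _; rewrite hornerD hornerX hornerC natrB ?natrD ?natrB //; first by ring.
by apply: leq_trans (ltnW (ltn_ord i)) (leq_addr _ _).
Qed.

Lemma eventually_poly_cell t (G : {set E}) : eventually_poly (fun n => num_comp n (cell t G)).
Proof.
case cG : #|G| => [|m].
  apply: (@eventually_poly_eventually _ _ (\sum_e t e).+1) eventually_poly0 => n lt.
  by rewrite (cards0_eq cG) num_cell0.
apply: (@eventually_poly_eventually _ _ (\sum_e t e)) (eventually_poly_bin m (\sum_e t e)) => n le.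
exact: num_cell.
Qed.

Definition truncI C a : {ffun E -> 'I_C.+1} := [ffun e => inord (minn (a e) C)].

Lemma truncIE C a e : truncI C a e = minn (a e) C :> nat.
Proof. by rewrite ffunE inordK // ltnS geq_minr. Qed.

(** Vectors are sorted by their truncation [t]; those in [P n] form the cell with free coordinates
    [G t]. Since [t] equals [C] on [G t], raising these coordinates keeps the truncation. The
    property may depend on [n], as attaining a least weight does. *)
Lemma eventually_poly_cells C (P : nat -> pred {ffun E -> nat})
    (Q : pred {ffun E -> 'I_C.+1}) (G : {ffun E -> 'I_C.+1} -> {set E}) n0 :
    (forall t e, e \in G t -> t e = C :> nat) ->
    (forall n a, (n0 <= n)%N -> (\sum_e a e = n)%N ->
       P n a = Q (truncI C a) &&
               [forall e, (e \notin G (truncI C a)) ==> (a e == truncI C a e)]) ->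
  eventually_poly (fun n => num_comp n (P n)).
Proof.
move=> GC PQ; pose f (t : {ffun E -> 'I_C.+1}) n := num_comp n (cell (fun e => t e : nat) (G t)).
apply: (@eventually_poly_eventually _ (fun n => \sum_(t | Q t) f t n)%N n0); last first.
  by apply: eventually_poly_sum => t _; apply: eventually_poly_cell.
move=> n le_n; rewrite /num_comp -sum1_card.
pose nf (a : {ffun E -> 'I_n.+1}) : {ffun E -> nat} := [ffun e => a e : nat].
have sum_nf (x : {ffun E -> 'I_n.+1}) : (\sum_e nf x e = \sum_e x e)%N
  by apply: eq_bigr => e _; rewrite ffunE.
rewrite (partition_big (fun x => truncI C (nf x)) Q) => [|x]; last first.
  by rewrite inE => /andP[/eqP an]; rewrite PQ ?sum_nf // => /andP[].
apply: eq_bigr => t Qt; rewrite sum1dep_card /f /num_comp.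
apply: eq_card => a; rewrite !inE; case: eqP => //= an.
rewrite PQ ?sum_nf //; apply/andP/forallP => [[/andP[Qa /forallP h] /eqP at_] e|h].
  have := h e; rewrite at_; case: ifP => //= _ _.
  by rewrite -at_ truncIE geq_minl.
have at_ : truncI C (nf a) = t.
  apply/ffunP => e; apply: val_inj; rewrite /= truncIE; have := h e.
  case: ifP => [/GC te|_ /eqP ->]; first by rewrite te => /minn_idPr.
  by apply/minn_idPl; rewrite -ltnS.
rewrite /nf in at_ *; rewrite at_ eqxx Qt; split=> //=; apply/forallP => e.
by have := h e; case: ifP.
Qed.

Definition trunc_invariant C (Q : pred {ffun E -> nat}) := forall a, Q (trunc C a) = Q a.

Definition natf C (t : {ffun E -> 'I_C.+1}) : {ffun E -> nat} := [ffun e => t e : nat].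

Lemma natf_truncI C a : natf (truncI C a) = trunc C a.
Proof. by apply/ffunP => e; rewrite [LHS]ffunE truncIE ffunE. Qed.

Lemma eventually_poly_trunc_invariant C Q : trunc_invariant C Q ->
  eventually_poly (fun n => num_comp n Q).
Proof.
(* Here every coordinate where the truncation equals [C] is free. *)
move=> QC; apply: (@eventually_poly_cells C _ (fun t => Q (natf t))
  (fun t => [set e | t e == C :> nat]) 0%N) => [t e|n a _ _].
  by rewrite inE => /eqP.
rewrite natf_truncI QC andb_idr // => _; apply/forallP => e; apply/implyP.
by rewrite inE truncIE minnC /minn; case: ltnP => //; rewrite eqxx.
Qed.

End Vectors.

(** * Eventual comparison of linear functions *)

Definition line_at (l : int * int) (n : nat) : int := l.1 * n%:Z + l.2.

Lemma lines_eventually_compare (l l' : int * int) : l != l' ->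
  exists n0, (forall n, (n0 <= n)%N -> line_at l n < line_at l' n) \/
             (forall n, (n0 <= n)%N -> line_at l' n < line_at l n).
Proof.
(* Distinct integer slopes differ by at least 1, so beyond this bound the slopes outweigh the gap
   between the intercepts. *)
case: l l' => [a b] [a' b'] ne; exists `|b - b'|%N.+1; rewrite /line_at /=.
have [lt|lt|e] := ltgtP a a'.
- left=> n le; suff : n%:Z <= (a' - a) * n%:Z by lia.
  by rewrite -{1}[n%:Z]mul1r ler_wpM2r //; lia.
- right=> n le; suff : n%:Z <= (a - a') * n%:Z by lia.
  by rewrite -{1}[n%:Z]mul1r ler_wpM2r //; lia.
rewrite e in ne *; have [lt|lt|e'] := ltgtP b b'.
- by left=> n _; rewrite ltrD2l.
- by right=> n _; rewrite ltrD2l.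
by rewrite e' eqxx in ne.
Qed.

(** Any two distinct lines are eventually strictly ordered, and there are finitely many. The
    strictness later identifies the vectors of least weight. *)
Lemma eventually_least_line (s : seq (int * int)) : s != [::] ->
  exists2 l, l \in s & exists n0, forall n, (n0 <= n)%N ->
    forall l', l' \in s -> l' != l -> line_at l n < line_at l' n.
Proof.
elim: s => // l1 s IHs _; have [->|/IHs [l ls [n0 lP]]] := eqVneq s [::].
  by exists l1; rewrite ?mem_head //; exists 0%N => n _ l'; rewrite inE => /eqP->; rewrite eqxx.
have [e|ne] := eqVneq l1 l.
  exists l; first by rewrite inE ls orbT.
  exists n0 => n le l'; rewrite inE e => /predU1P[->|]; first by rewrite eqxx.
  exact: lP.
have [n1 [lt1|lt1]] := lines_eventually_compare ne.
  exists l1; first exact: mem_head.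
  exists (maxn n0 n1) => n; rewrite geq_max => /andP[h0 h1] l'.
  rewrite inE => /predU1P[->|l's _]; first by rewrite eqxx.
  have [->|ne'] := eqVneq l' l; first exact: lt1.
  exact: lt_trans (lt1 n h1) (lP n h0 l' l's ne').
exists l; first by rewrite inE ls orbT.
exists (maxn n0 n1) => n; rewrite geq_max => /andP[h0 h1] l'.
rewrite inE => /predU1P[-> _|]; [exact: lt1|exact: lP].
Qed.

(** * Least weight in a truncation-invariant set of vectors *)

Section Weights.
Variables (E : finType) (w : E -> nat) (C : nat) (Q : pred {ffun E -> nat}).
Hypothesis QC : trunc_invariant C Q.
Implicit Types (a : {ffun E -> nat}) (t : {ffun E -> 'I_C.+1}).

Definition weight a : nat := (\sum_e a e * w e)%N.

(* The weight, as a function of n, of the vector of sum n obtained from t by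
   raising only the coordinate e. *)
Definition ray t e : int * int :=
  ((w e)%:Z, (weight (natf t))%:Z - (\sum_e t e)%N%:Z * (w e)%:Z).

(** The finitely many candidates for the least weight. Only coordinates where the truncation equals
    [C] can be raised without changing it. *)
Definition rays : seq (int * int) :=
  [seq ray x.1 x.2 | x <- enum {: {ffun E -> 'I_C.+1} * E} &
    Q (natf x.1) && (x.1 x.2 == C :> nat)].

Lemma mem_rays t e : Q (natf t) -> t e = C :> nat -> ray t e \in rays.
Proof.
move=> Qt te; apply/mapP; exists (t, e) => //.
by rewrite mem_filter /= Qt te eqxx mem_enum.
Qed.

Lemma truncI_le a e : (truncI C a e <= a e)%N.
Proof. by rewrite truncIE geq_minl. Qed.

Lemma truncI_lt a e : (truncI C a e < a e)%N -> truncI C a e = C :> nat.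
Proof. by rewrite truncIE; lia. Qed.

(** Truncated entries are at most [C], so a larger total leaves an excess: the positive total mass
    of the average in [weight_average]. *)
Lemma sum_truncI a : (#|E| * C < \sum_e a e)%N ->
  (\sum_e truncI C a e < \sum_e a e)%N.
Proof.
apply: leq_ltn_trans; rewrite -sum_nat_const; apply: leq_sum => e _.
by rewrite -ltnS.
Qed.

(* Beyond its truncation t, the vector a is a weighted average of the rays at t. *)
Lemma weight_average a : let t := truncI C a in
  (\sum_e a e - \sum_e t e)%N%:Z * (weight a)%:Z =
  \sum_e (a e - t e)%N%:Z * line_at (ray t e) (\sum_e a e)%N.
Proof.
move=> t; set n := (\sum_e a e)%N; set m := (\sum_e t e)%N.
have le_mn : (m <= n)%N by apply: leq_sum => e _; apply: truncI_le.
have dE : (\sum_e (a e - t e) = n - m)%N by rewrite sumnB // => e _; apply: truncI_le.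
have wE : weight a = (weight (natf t) + \sum_e (a e - t e) * w e)%N.
  rewrite /weight -big_split; apply: eq_bigr => e _ /=.
  by rewrite ffunE -mulnDl subnKC ?truncI_le.
have lE e : line_at (ray t e) n = (weight (natf t))%:Z + (n - m)%N%:Z * (w e)%:Z.
  by rewrite /line_at /ray /= -/m -subzn //; ring.
under eq_bigr do rewrite lE mulrDr mulrCA.
rewrite big_split /= -mulr_suml -mulr_sumr wE PoszD mulrDr; congr (_ * _ + _ * _).
  by rewrite -dE; apply: (big_morph Posz PoszD).
rewrite (big_morph Posz PoszD (id1 := 0%N)) //.
Qed.

(** By [weight_average], a weight is at least the value of the eventually least ray [l], with
    equality exactly when every coordinate exceeding its truncation has ray [l]. Without rays, [Q]
    contains no vector of large sum, since such a vector has a coordinate exceeding its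
    truncation. *)
Lemma least_weight :
  (exists n0, forall n a, (n0 <= n)%N -> (\sum_e a e = n)%N -> ~~ Q a) \/
  exists (l : int * int) n0,
    [/\ (forall n, (n0 <= n)%N -> exists a,
           [/\ (\sum_e a e = n)%N, Q a & (weight a)%:Z = line_at l n]),
        (forall n a, (n0 <= n)%N -> (\sum_e a e = n)%N -> Q a ->
           line_at l n <= (weight a)%:Z) &
        eventually_poly (fun n => num_comp n (fun a => Q a && ((weight a)%:Z == line_at l n)))].
Proof.
have ray_of n a : (#|E| * C < n)%N -> (\sum_e a e = n)%N -> Q a ->
    exists e, ray (truncI C a) e \in rays.
  move=> lt an Qa; have := sum_truncI; move=> /(_ a); rewrite an => /(_ lt) lt'.
  have [e lte|h] := pickP (fun e => (truncI C a e < a e)%N).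
    by exists e; apply: mem_rays (truncI_lt lte); rewrite natf_truncI QC.
  suff : (n <= \sum_e truncI C a e)%N by rewrite leqNgt lt'.
  by rewrite -an; apply: leq_sum => e _; rewrite leqNgt h.
have [rays0|/eventually_least_line[l lr [n0 lP]]] := eqVneq rays [::].
  left; exists (#|E| * C).+1 => n a lt an; apply/negP => Qa.
  by have [e] := ray_of n a lt an Qa; rewrite rays0.
right; exists l, (maxn n0 (#|E| * C).+1).
(* Termwise comparison in the average; its equality case comes from the strict minimality of [l]. *)
have lle n a e : (maxn n0 (#|E| * C).+1 <= n)%N -> Q a ->
    (a e - truncI C a e)%N%:Z * line_at l n <=
      (a e - truncI C a e)%N%:Z * line_at (ray (truncI C a) e) n
      ?= iff ((truncI C a e < a e)%N ==> (ray (truncI C a) e == l)).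
  rewrite geq_max => /andP[h0 h1] Qa; have [lte|] := ltnP (truncI C a e) (a e) => /=.
    have := mem_rays _ (truncI_lt lte); rewrite natf_truncI QC => /(_ Qa) rr.
    have d0 : 0 < (a e - truncI C a e)%N%:Z by rewrite ltz_nat subn_gt0.
    rewrite (mono_leif (ler_pM2l d0)).
    have [->|ne] := eqVneq; first exact/leif_refl.
    by have lt := lP n h0 _ rr ne; split; [exact: ltW|rewrite lt_eqF].
  by rewrite -subn_eq0 => /eqP ->; rewrite !mul0r; apply/leif_refl.
(* The termwise comparisons are summed, and the positive total mass of the average is cancelled. *)
have wle n a : (maxn n0 (#|E| * C).+1 <= n)%N -> (\sum_e a e = n)%N -> Q a ->
    line_at l n <= (weight a)%:Z
      ?= iff [forall e, (truncI C a e < a e)%N ==> (ray (truncI C a) e == l)].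
  move=> le an Qa; have lt' : (\sum_e truncI C a e < n)%N.
    by rewrite -an; apply: sum_truncI; rewrite an; move: le; rewrite geq_max => /andP[].
  have d0 : 0 < (n - \sum_e truncI C a e)%N%:Z by rewrite ltz_nat subn_gt0.
  rewrite -(mono_leif (ler_pM2l d0)); have := weight_average a; rewrite /= an => ->.
  have -> : (n - \sum_e truncI C a e)%N%:Z * line_at l n =
      \sum_e (a e - truncI C a e)%N%:Z * line_at l n.
    rewrite -mulr_suml -{1}an -sumnB => [|e _]; last exact: truncI_le.
    by congr (_ * _); apply: (big_morph Posz PoszD).
  by apply: leif_sum => e _; apply: lle.
split.
- move=> n; rewrite geq_max => /andP[_ lt].
  have /mapP[[t e0]] := lr; rewrite mem_filter /= => /andP[/andP[Qt /eqP te0] _] lE.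
  have le_tn : (\sum_e t e <= n)%N.
    apply: leq_trans (ltnW lt); rewrite -sum_nat_const; apply: leq_sum => e _.
    by rewrite -ltnS.
  set d := (n - \sum_e t e)%N.
  (* The whole excess goes to [e0], where [t] already equals [C]: the truncation stays [t] and the
     weight is the value of the ray at [n]. *)
  pose a : {ffun E -> nat} := [ffun e => (t e + (e == e0) * d)%N].
  have single (f : E -> nat) : (\sum_e (e == e0) * d * f e = d * f e0)%N.
    by rewrite (bigD1 e0) //= eqxx mul1n big1 ?addn0 // => e /negbTE ->.
  exists a; split.
  - under eq_bigr do rewrite ffunE -[X in (_ + X)%N]muln1.
    by rewrite big_split /= (single (fun=> 1%N)) muln1 subnKC.
  - rewrite -QC; suff -> : trunc C a = natf t by [].
    apply/ffunP => e; rewrite !ffunE; case: eqP => [->|_].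
      by rewrite te0; apply/minn_idPr/leq_addr.
    by rewrite mul0n addn0; apply/minn_idPl; rewrite -ltnS.
  have -> : weight a = (weight (natf t) + d * w e0)%N.
    rewrite -single /weight -big_split; apply: eq_bigr => e _ /=.
    by rewrite !ffunE mulnDl.
  by rewrite lE /line_at /ray /= PoszD PoszM /d -subzn //; ring.
- by move=> n a le an Qa; have [] := wle n a le an Qa.
(* For vectors of least weight, the free coordinates are those where [t] equals [C] and whose ray is
   [l]. *)
apply: (@eventually_poly_cells _ C _ (fun t => Q (natf t))
  (fun t => [set e | (t e == C :> nat) && (ray t e == l)]) (maxn n0 (#|E| * C).+1)).
  by move=> t e; rewrite inE => /andP[/eqP].
move=> n a le an; rewrite natf_truncI QC; have [Qa|//] := boolP (Q a).
rewrite /= eq_sym; have [_ ->] := wle n a le an Qa.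
apply: eq_forallb => e; rewrite inE.
have [lte|ge] := ltnP (truncI C a e) (a e).
  by rewrite (gtn_eqF lte) (truncI_lt lte) eqxx implybF negbK.
have -> : a e == truncI C a e by rewrite eqn_leq ge truncI_le.
by rewrite implybT.
Qed.

End Weights.

(** * Squarefree monomial ideals and their duals *)

Section Support.
Variable N : nat.
Implicit Types (S T : {set 'I_N}) (m : 'X_{1..N}).

Definition sfmon S : 'X_{1..N} := [multinom (i \in S : nat) | i < N].

Definition msupport m : {set 'I_N} := [set i | m i != 0%N].

Lemma msupport_sfmon S : msupport (sfmon S) = S.
Proof. by apply/setP=> i; rewrite inE mnmE; case: (i \in S). Qed.

Lemma sfmon_le S m : (sfmon S <= m)%MM = (S \subset msupport m).
Proof.
apply/mnm_lepP/subsetP => h i.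
  by move=> iS; have := h i; rewrite mnmE iS inE -lt0n.
rewrite mnmE; case: (boolP (i \in S)) => // /h.
by rewrite inE -lt0n.
Qed.

Lemma msupport_le m m' : (m <= m')%MM -> msupport m \subset msupport m'.
Proof.
move/mnm_lepP=> h; apply/subsetP => i; rewrite !inE -!lt0n => mi.
exact: leq_trans mi (h i).
Qed.

Lemma squarefree_sfmon m : squarefree m -> m = sfmon (msupport m).
Proof.
move=> sqm; apply/mnmP => i; rewrite mnmE inE.
by have := sqm i; case: (m i) => [|[]].
Qed.

Lemma msupportD m m' : msupport (m + m')%MM = msupport m :|: msupport m'.
Proof. by apply/setP=> i; rewrite !inE mnmDE addn_eq0 negb_and. Qed.

Lemma msupport1 i : msupport U_(i)%MM = [set i].
Proof. by apply/setP=> j; rewrite !inE mnm1E [in RHS]eq_sym; case: (i == j). Qed.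

Lemma mdeg_sfmon S : mdeg (sfmon S) = #|S|.
Proof.
rewrite mdegE -sum1_card [RHS]big_mkcond; apply: eq_bigr => i _.
by rewrite mnmE; case: (i \in S).
Qed.

End Support.

Section MonomialIdeals.
Variables (k : fieldType) (N : nat).
Implicit Types (I J : {mpoly k[N]} -> Prop) (m : 'X_{1..N}) (S T : {set 'I_N}).

Lemma ideal_gen_is_ideal (A : comNzRingType) (G : A -> Prop) :
  is_ideal (ideal_gen G).
Proof.
split=> [J [J0 _ _] _ //|f g If Ig J iJ GJ|f g Ig J iJ GJ]; have [_ JD JM] := iJ.
  exact: JD (If J iJ GJ) (Ig J iJ GJ).
exact: JM (Ig J iJ GJ).
Qed.

Lemma eq_ideal_gen (A : comNzRingType) (G G' : A -> Prop) f :
  (forall g, G g <-> G' g) -> ideal_gen G f <-> ideal_gen G' f.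
Proof. by move=> GG'; split=> h J iJ sJ; apply: h => // g /GG' /sJ. Qed.

Lemma ideal_msupp I f :
  is_ideal I -> (forall m, m \in msupp f -> I 'X_[m]) -> I f.
Proof.
move=> [I0 ID IM] h; rewrite [f]mpolyE big_seq.
elim/big_ind: _ => // m /h Im; rewrite -mul_mpolyC; exact: IM.
Qed.

(** The polynomials on the right form an ideal containing the generators; conversely, each of their
    terms is a multiple of a generator. *)
Lemma monomial_genP (G : 'X_{1..N} -> Prop) (f : {mpoly k[N]}) :
  monomial_gen G f <->
  forall m, m \in msupp f -> exists2 m0, G m0 & (m0 <= m)%MM.
Proof.
split=> [h|h].
  apply: (h (fun f => forall m, m \in msupp f ->
                      exists2 m0, G m0 & (m0 <= m)%MM)); last first.
    move=> _ [m Gm ->] m'; rewrite msuppX inE => /eqP ->.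
    by exists m => //; apply: lepm_refl.
  split=> [m|f1 f2 h1 h2 m /msuppD_le|f1 f2 h2 m /msuppM_le]; first by rewrite msupp0.
    by rewrite mem_cat => /orP[/h1|/h2].
  case/allpairsP => -[m1 m2] [/= _ /h2[m0 Gm0 le02] ->].
  by exists m0 => //; apply: lepm_trans le02 (lem_addl _ _).
have idG := ideal_gen_is_ideal (fun f : {mpoly k[N]} => exists2 m, G m & f = 'X_[m]).
apply: ideal_msupp => // m /h [m0 Gm0 le0].
have [_ _ GM] := idG.
rewrite -(submK le0) mpolyXD; apply: GM => J _; apply; by exists m0.
Qed.

Lemma monomial_genX (G : 'X_{1..N} -> Prop) m :
  monomial_gen G ('X_[m] : {mpoly k[N]}) <-> exists2 m0, G m0 & (m0 <= m)%MM.
Proof.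
rewrite monomial_genP; split=> [|h m']; first by apply; rewrite msuppX inE.
by rewrite msuppX inE => /eqP ->.
Qed.

Lemma monomial_primeP m (f : {mpoly k[N]}) :
  monomial_prime m f <->
  forall m', m' \in msupp f -> ~~ [disjoint msupport m & msupport m'].
Proof.
transitivity (monomial_gen (fun m' => exists2 i, i \in msupport m & m' = U_(i)%MM) f).
  apply: eq_ideal_gen => g; split=> [[i im ->]|[_ [i im ->] ->]].
    by exists U_(i)%MM => //; exists i => //; rewrite inE -lep1mP.
  by exists i => //; rewrite lep1mP; rewrite inE in im.
rewrite monomial_genP; split=> h m' /h.
  move=> [_ [i im ->]]; rewrite lep1mP => im'.
  by apply/pred0Pn; exists i; rewrite /= im inE.
case/pred0Pn=> i /= /andP[im im']; exists U_(i)%MM; first by exists i.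
by rewrite lep1mP; rewrite inE in im'.
Qed.

(** This endomorphism sets the variables of [T] to zero. Its kernel is the monomial prime on [T],
    which is prime because the polynomial ring is a domain. *)
Definition kill_vars T : {mpoly k[N]} -> {mpoly k[N]} :=
  comp_mpoly [tuple if i \in T then 0 else 'X_i | i < N].

Lemma kill_varsX T m :
  kill_vars T 'X_[m] = [disjoint T & msupport m]%:R *: 'X_[m].
Proof.
rewrite /kill_vars comp_mpolyX.
case: (boolP [disjoint T & msupport m]) => [dis|/pred0Pn[i /=/andP[iT im]]].
  rewrite scale1r [RHS]mpolyXE_id; apply: eq_bigr => i _; rewrite tnth_mktuple.
  case: ifP => // iT; have := disjointFr dis iT.
  by rewrite inE => /negbFE/eqP ->; rewrite !expr0.
rewrite scale0r (bigD1 i) //= tnth_mktuple iT expr0n.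
by rewrite inE in im; rewrite (negbTE im) mul0r.
Qed.

Lemma monomial_prime_kill m (f : {mpoly k[N]}) :
  monomial_prime m f <-> kill_vars (msupport m) f = 0.
Proof.
have killE : kill_vars (msupport m) f =
    \sum_(m' <- msupp f) (f@_m' * [disjoint msupport m & msupport m']%:R) *: 'X_[m'].
  rewrite {1}[f]mpolyE /kill_vars raddf_sum; apply: eq_bigr => m' _ /=.
  by rewrite comp_mpolyZ -/(kill_vars _ _) kill_varsX scalerA.
rewrite monomial_primeP killE; split=> [h|h m' m'f].
  rewrite big_seq big1 // => m' /h /negbTE ->.
  by rewrite mulr0 scale0r.
apply/negP => dis; have := congr1 (mcoeff m') h.
rewrite mcoeff0 raddf_sum (bigD1_seq m') //= big1.
  rewrite addr0 mcoeffZ mcoeffX eqxx dis !mulr1 => /eqP.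
  by apply/negP; rewrite -mcoeff_msupp.
by move=> m2 ne; rewrite mcoeffZ mcoeffX (negbTE ne) mulr0.
Qed.

Lemma monomial_prime_is_prime m : is_prime_ideal (@monomial_prime k N m).
Proof.
split; first exact: ideal_gen_is_ideal.
  by move/monomial_prime_kill/eqP; rewrite /kill_vars comp_mpoly1 oner_eq0.
move=> f g; rewrite !monomial_prime_kill /kill_vars rmorphM /=.
by move/eqP; rewrite mulf_eq0 => /orP[]/eqP; [left|right].
Qed.

(** * Facets and associated primes *)

Definition nonface I S : Prop := I 'X_[sfmon S].

(** Testing one added variable at a time suffices for maximality, because nonfaces of an ideal are
    closed under supersets. *)
Definition facet I S : Prop :=
  ~ nonface I S /\ forall i, i \notin S -> nonface I (i |: S).

(** A squarefree generator divides a monomial as soon as it divides the product of the variables in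
    its support. *)
Lemma squarefree_idealP I f : squarefree_monomial_ideal I ->
  I f <-> forall m, m \in msupp f -> nonface I (msupport m).
Proof.
move=> [G sqG IG]; rewrite IG monomial_genP; split=> h m /h.
  move=> [m0 Gm0 le0]; apply/IG/monomial_genX; exists m0 => //.
  by rewrite (squarefree_sfmon (sqG _ Gm0)) sfmon_le msupport_sfmon msupport_le.
move/IG/monomial_genX => [m0 Gm0 le0]; exists m0 => //.
by apply: lepm_trans le0 _; rewrite sfmon_le.
Qed.

Lemma squarefree_ideal_is_ideal I : squarefree_monomial_ideal I -> is_ideal I.
Proof.
move=> [G _ IG]; have [G0 GD GM] := ideal_gen_is_ideal
  (fun f : {mpoly k[N]} => exists2 m, G m & f = 'X_[m]).
split=> [|f g /IG If /IG Ig|f g /IG Ig]; apply/IG => //; [exact: GD|exact: GM].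
Qed.

Lemma nonface_sub I S T :
  is_ideal I -> S \subset T -> nonface I S -> nonface I T.
Proof.
move=> [_ _ IM] sST; rewrite /nonface => IS.
have le : (sfmon S <= sfmon T)%MM by rewrite sfmon_le msupport_sfmon.
by rewrite -(submK le) mpolyXD; apply: IM.
Qed.

Lemma facet_antichain I S T :
  is_ideal I -> facet I S -> facet I T -> S \subset T -> S = T.
Proof.
move=> iI [_ maxS] [nT _] sST; apply/eqP; rewrite eqEsubset sST /=.
apply/subsetP => i iT; apply/negPn/negP => iS; apply: nT.
by apply: nonface_sub (maxS i iS) => //; rewrite subUset sub1set iT.
Qed.

Lemma facet_exists I : is_ideal I -> ~ I 1 -> exists S, facet I S.
Proof.
move=> iI n1; have n0 : ~~ `[< nonface I set0 >].
  apply/negP => /asboolP; rewrite /nonface => h; apply: n1.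
  suff <- : 'X_[sfmon set0] = 1 :> {mpoly k[N]} by [].
  rewrite -mpolyX0; congr mpolyX; apply/mnmP => i.
  by rewrite mnmE inE mnm0E.
have [S /maxsetP[nS maxS] _] :=
  @maxset_exists _ (fun S => ~~ `[< nonface I S >]) _ n0.
exists S; split=> [/asboolP h|i iS]; first by rewrite h in nS.
apply: contrapT => h; move/negP: iS; apply.
by rewrite -(maxS (i |: S)) ?setU11 ?subsetUr //; apply/asboolPn.
Qed.

Lemma msuppMXP (f : {mpoly k[N]}) m m' :
  m' \in msupp (f * 'X_[m]) <-> exists2 m0, m0 \in msupp f & m' = (m + m0)%MM.
Proof.
rewrite (perm_mem (msuppMX f m)); split; first by case/mapP=> m0; exists m0.
by move=> [m0 fm0 ->]; apply/mapP; exists m0.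
Qed.

(** If the prime is [(I : f)], a monomial of [f] supported on a face avoids the variables of the
    prime: multiplying by one that divides it would keep the support and yield a nonface.
    Conversely, the product of the variables not dividing [m] serves as [f]. *)
Lemma associated_monomial_prime I m : squarefree_monomial_ideal I ->
  associated_prime I (monomial_prime m) <-> facet I (~: msupport m).
Proof.
move=> sqI; have iI := squarefree_ideal_is_ideal sqI.
split=> [[_ [f fP]]|[nF maxF]].
  have subF m' : m' \in msupp f -> ~ nonface I (msupport m') -> msupport m' \subset ~: msupport m.
    move=> fm' nm'; apply/subsetP => i im'; rewrite inE; apply/negP => im.
    have /fP : monomial_prime m ('X_i : {mpoly k[N]}).
      apply/monomial_primeP => m''; rewrite msuppX inE => /eqP ->.
      by rewrite msupport1; apply/pred0Pn; exists i; rewrite /= im set11.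
    rewrite mulrC => /(squarefree_idealP _ sqI) /(_ (U_(i) + m')%MM).
    rewrite msupportD msupport1 => h; apply: nm'.
    suff -> : msupport m' = i |: msupport m' by apply/h/msuppMXP; exists m'.
    by apply/esym/setUidPr; rewrite sub1set.
  have facem' (g : {mpoly k[N]}) : ~ monomial_prime m g ->
      exists2 m', m' \in msupp (g * f) & ~ nonface I (msupport m').
    move=> ng; apply: contrapT => h; apply/ng/fP/(squarefree_idealP _ sqI) => m' m'gf.
    by apply: contrapT => nm'; apply: h; exists m'.
  split.
    (* The product of the variables outside the prime is not in the prime, so its multiple by [f]
       has a monomial supported on a face, and this face contains all those variables. *)
    have nX : ~ monomial_prime m ('X_[sfmon (~: msupport m)] : {mpoly k[N]}).
      move/monomial_primeP/(_ (sfmon (~: msupport m))); rewrite msuppX inE eqxx.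
      rewrite msupport_sfmon => /(_ isT)/negP; apply.
      by rewrite -setI_eq0 setICr.
    have [m'] := facem' _ nX; rewrite mulrC => /msuppMXP[m0 _ ->].
    rewrite msupportD msupport_sfmon => nm' hF; apply: nm'.
    by apply: nonface_sub hF => //; apply: subsetUl.
  move=> i; rewrite inE negbK => im.
  (* As 1 is not in the prime, [f] itself has a monomial [m'] supported on a face; adding [i] to its
     support gives a nonface inside the set to be tested. *)
  have n1 : ~ monomial_prime m (1 : {mpoly k[N]}).
    by have [_] := monomial_prime_is_prime m.
  have [m'] := facem' _ n1; rewrite mul1r => fm' nm'.
  have sub' := subF _ fm' nm'.
  have /fP : monomial_prime m ('X_i : {mpoly k[N]}).
    apply/monomial_primeP => m''; rewrite msuppX inE => /eqP ->.
    by rewrite msupport1; apply/pred0Pn; exists i; rewrite /= im set11.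
  rewrite mulrC => /(squarefree_idealP _ sqI) /(_ (U_(i) + m')%MM).
  rewrite msupportD msupport1 => h.
  apply: (@nonface_sub _ (i |: msupport m')) => //; first exact: setUS.
  by apply/h/msuppMXP; exists m'.
split; first exact: monomial_prime_is_prime.
exists 'X_[sfmon (~: msupport m)] => g.
rewrite monomial_primeP (squarefree_idealP _ sqI); split=> h.
  move=> _ /msuppMXP[m0 /h /pred0Pn[i /andP[im im0]] ->].
  rewrite msupportD msupport_sfmon; apply: (@nonface_sub _ (i |: ~: msupport m)) => //.
    by rewrite setUC setUS // sub1set.
  by apply: maxF; rewrite inE negbK.
move=> m' gm'; apply/negP => dis; apply: nF.
have := h (sfmon (~: msupport m) + m')%MM; rewrite msupportD msupport_sfmon.
rewrite (setUidPl _); first by apply; apply/msuppMXP; exists m'.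
by rewrite -disjoints_subset disjoint_sym.
Qed.

(** * Minimal generators of a monomial ideal and of the dual *)

Lemma minimal_monomial_below (P : 'X_{1..N} -> Prop) m : P m ->
  exists m0, [/\ P m0, (m0 <= m)%MM &
                 forall m', P m' -> (m' <= m0)%MM -> m' = m0].
Proof.
have [d] := ubnP (mdeg m); elim: d m => // d IHd m mltd Pm.
have [h|h] := pselect (forall m', P m' -> (m' <= m)%MM -> m' = m).
  by exists m; split=> //; apply: lepm_refl.
have [m' [Pm' m'm ne]] : exists m', [/\ P m', (m' <= m)%MM & m' != m].
  apply: contrapT => nex; apply: h => m' Pm' le'; apply/eqP/negPn/negP => ne.
  by apply: nex; exists m'.
have [|m0 [Pm0 m0m' min0]] := IHd m' _ Pm'.
  rewrite ltnS in mltd; apply: leq_trans mltd.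
  rewrite -(submK m'm) mdegD -[X in (X < _)%N]add0n ltn_add2r lt0n mdeg_eq0.
  apply: contra ne => /eqP d0; apply/eqP.
  by rewrite -[RHS](submK m'm) d0 add0m.
by exists m0; split=> //; apply: lepm_trans m0m' m'm.
Qed.

(** In a minimal generating set, an element with a proper divisor in the set could be dropped;
    antisymmetry of divisibility carries this over to [G]. Conversely, the divisibility-minimal
    elements of [G] generate, by descent on the degree. *)
Lemma minimal_generatorP (G : 'X_{1..N} -> Prop) J m :
  (forall f, J f <-> monomial_gen G f) ->
  minimal_generator J m <->
  G m /\ forall m', G m' -> (m' <= m)%MM -> m' = m.
Proof.
move=> JG; have lem_anti m1 m2 : (m1 <= m2)%MM -> (m2 <= m1)%MM -> m1 = m2.
  move=> /mnm_lepP h1 /mnm_lepP h2; apply/mnmP => i; apply/eqP.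
  by rewrite eqn_leq h1 h2.
split=> [[G' [JG' minG'] G'm]|[Gm min_m]].
  have minG'm m' : G' m' -> (m' <= m)%MM -> m' = m.
    move=> G'm' le'; apply: contrapT => ne.
    have [] // : G' m /\ m <> m.
    apply: (minG' (fun m0 => G' m0 /\ m0 <> m)) => // [_ []//|f].
    rewrite JG' !monomial_genP; split=> h m1 /h [m0 G'm0 le0]; last first.
      by exists m0 => //; have [] := G'm0.
    have [m0m|] := pselect (m0 = m); last by exists m0.
    by exists m' => //; apply: lepm_trans le' _; rewrite -m0m.
  have JGX m1 m2 : G m1 -> (m1 <= m2)%MM -> J 'X_[m2].
    by move=> Gm1 le12; apply/JG/monomial_genX; exists m1.
  have below m' : G m' -> (m' <= m)%MM -> m' = m.
    move=> Gm' le'; have /JG'/monomial_genX[m1 G'm1 le1] := JGX _ _ Gm' (lepm_refl m').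
    by apply: lem_anti => //; rewrite -(minG'm m1) // (lepm_trans le1).
  split=> //; have /JG/monomial_genX[m0 Gm0 le0] : J 'X_[m].
    by apply/JG'/monomial_genX; exists m => //; apply: lepm_refl.
  by rewrite -(below _ Gm0 le0).
exists (fun m => G m /\ forall m', G m' -> (m' <= m)%MM -> m' = m) => //.
split=> [f|G' subG' JG' m' [Gm' min_m']].
  rewrite JG !monomial_genP; split=> h m' /h [m0 Gm0 le0].
    have [m1 [Gm1 le1 min1]] := minimal_monomial_below Gm0.
    by exists m1; last apply: lepm_trans le1 le0.
  by exists m0 => //; have [] := Gm0.
have /JG'/monomial_genX[m0 G'm0 le0] : J 'X_[m'].
  by apply/JG/monomial_genX; exists m' => //; apply: lepm_refl.
have [Gm0 _] := subG' _ G'm0.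
by rewrite -(min_m' _ Gm0 le0).
Qed.

(** The monomials defining the dual need not be squarefree, but minimality leaves only the
    squarefree one for each support. Distinct facets are incomparable, so the complement of every
    facet survives. *)
Lemma dual_minimal_generator I m : squarefree_monomial_ideal I ->
  minimal_generator (alexander_dual I) m <->
  exists2 S, facet I S & m = sfmon (~: S).
Proof.
move=> sqI; have iI := squarefree_ideal_is_ideal sqI.
rewrite (@minimal_generatorP (fun m => associated_prime I (monomial_prime m))) //.
split=> [[/(associated_monomial_prime _ sqI) fm min_m]|[S fS ->]].
  exists (~: msupport m) => //; rewrite setCK; apply/esym/min_m.
    by apply/associated_monomial_prime => //; rewrite msupport_sfmon.
  by rewrite sfmon_le.
split; first by apply/associated_monomial_prime; rewrite // msupport_sfmon setCK.
move=> m' /(associated_monomial_prime _ sqI) fm' le'.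
have := msupport_le le'; rewrite msupport_sfmon -[msupport m']setCK setCS => sS.
rewrite (facet_antichain iI fS fm' sS) setCK; apply: squarefree_sfmon => i.
by have /mnm_lepP/(_ i) := le'; rewrite mnmE => h; apply: leq_trans h (leq_b1 _).
Qed.

End MonomialIdeals.

(** * Column profiles and chains *)

Lemma count_mem_flatten_nseq (T : finType) (a : T -> nat) (x : T) :
  count_mem x (flatten [seq nseq (a y) y | y <- enum T]) = a x.
Proof.
rewrite count_flatten -map_comp sumnE big_map big_enum /= (bigD1 x) //=.
rewrite count_nseq /= eqxx mul1n big1 ?addn0 // => y ne.
by rewrite count_nseq /= (negbTE ne).
Qed.

Lemma big_mxvec (R : Type) (idx : R) (op : Monoid.com_law idx) (m n : nat)
    (F : 'I_(m * n) -> R) :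
  \big[op/idx]_l F l = \big[op/idx]_(i < m) \big[op/idx]_(j < n) F (mxvec_index i j).
Proof.
rewrite pair_bigA (reindex _ (curry_mxvec_bij m n)).
by apply: eq_big => [[i j]|[i j]].
Qed.

Section Columns.
Variable c : nat.

Section FixedN.
Variable n : nat.
Implicit Types (S : {set 'I_(c * n)}).

Definition col S (j : 'I_n) : {set 'I_c} := [set i | mxvec_index i j \in S].

Definition of_cols (t : 'I_n -> {set 'I_c}) : {set 'I_(c * n)} :=
  [set l | [exists i, exists j, (l == mxvec_index i j) && (i \in t j)]].

Definition profile S : {ffun {set 'I_c} -> nat} :=
  [ffun A => (\sum_(j < n) (col S j == A))%N].

Lemma mxvec_index_inj (i i' : 'I_c) (j j' : 'I_n) :
  mxvec_index i j = mxvec_index i' j' -> i = i' /\ j = j'.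
Proof.
have [g gK _] := curry_mxvec_bij c n => e.
by have := congr1 g e; rewrite -!/(uncurry (@mxvec_index c n) (_, _)) !gK ?inE // => -[].
Qed.

Lemma col_of_cols t : col (of_cols t) =1 t.
Proof.
move=> j; apply/setP => i; rewrite !inE; apply/existsP/idP.
  by move=> [i' /existsP[j' /andP[/eqP /mxvec_index_inj[-> ->]]]].
by move=> it; exists i; apply/existsP; exists j; rewrite eqxx.
Qed.

Lemma colC S j : col (~: S) j = ~: col S j.
Proof. by apply/setP => i; rewrite !inE. Qed.

Lemma count_col S A : count_mem A [seq col S j | j <- enum 'I_n] = profile S A.
Proof.
rewrite ffunE -sum1_count big_map big_enum_cond /= big_mkcond.
by apply: eq_bigr => j _; case: eqP.
Qed.

Lemma sum_profile (w : {set 'I_c} -> nat) S :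
  (\sum_A profile S A * w A = \sum_j w (col S j))%N.
Proof.
under eq_bigr do rewrite ffunE big_distrl.
rewrite exchange_big; apply: eq_bigr => j _ /=.
rewrite (bigD1 (col S j)) //= eqxx mul1n big1 ?addn0 // => A.
by rewrite eq_sym => /negbTE ->.
Qed.

Lemma sum_profile1 S : (\sum_A profile S A = n)%N.
Proof.
have := sum_profile (fun=> 1%N) S; rewrite sum1_card card_ord => <-.
by apply: eq_bigr => A _; rewrite muln1.
Qed.

Lemma card_setC_profile S : #|~: S| = (\sum_A profile S A * #|~: A|)%N.
Proof.
rewrite sum_profile -sum1_card big_mkcond big_mxvec exchange_big. apply: eq_bigr => j _.
rewrite -colC -sum1_card [RHS]big_mkcond; apply: eq_bigr => i _.
by rewrite !inE.
Qed.

Lemma profile_surj (a : {ffun {set 'I_c} -> nat}) :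
  (\sum_A a A = n)%N -> exists S, profile S = a.
Proof.
move=> an; pose s := flatten [seq nseq (a A) A | A <- enum {set 'I_c}].
have sz : size s = n.
  rewrite size_flatten /shape -map_comp sumnE big_map big_enum -[RHS]an.
  by apply: eq_bigr => A _; rewrite /= size_nseq.
exists (of_cols (fun j => nth set0 s j)); apply/ffunP => A.
rewrite -count_col -[RHS](count_mem_flatten_nseq a) -/s; congr (count_mem A _).
apply: (@eq_from_nth _ set0) => [|j]; rewrite size_map size_enum_ord // => jn.
by rewrite (nth_map (Ordinal jn)) ?size_enum_ord // col_of_cols nth_enum_ord.
Qed.

(* Only meaningful when [0 < a A], because of the truncated subtraction. *)
Definition enlarge (a : {ffun {set 'I_c} -> nat}) A (i : 'I_c) :=
  [ffun B => (a B - (A == B) + (i |: A == B))%N].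

Lemma profile_setU1 S i j : i \notin col S j ->
  profile (mxvec_index i j |: S) = enlarge (profile S) (col S j) i.
Proof.
move=> ij.
have colU j' : col (mxvec_index i j |: S) j' =
    if j' == j then i |: col S j else col S j'.
  apply/setP => i'; rewrite !inE; case: (j' =P j) => [->|ne]; rewrite !inE.
    by congr orb; apply/eqP/eqP => [/mxvec_index_inj[]|->].
  by case: eqP => // /mxvec_index_inj[].
apply/ffunP => B; rewrite !ffunE (bigD1 j) //= [in RHS](bigD1 j) //=.
rewrite colU eqxx addKn addnC; congr addn; apply: eq_bigr => j' /negbTE ne.
by rewrite colU ne.
Qed.

End FixedN.

(** The columns of [S], padded by the surplus columns of [S'], list the columns of [S'] up to a
    permutation. The padding comes last, so the first [m] positions hold the columns of [S] in
    order. *)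
Lemma embed_cols m n (S : {set 'I_(c * m)}) (S' : {set 'I_(c * n)}) :
  (forall A, profile S A <= profile S' A)%N ->
  exists (le_mn : (m <= n)%N) (s : 'S_n),
    forall j, col S' (s (widen_ord le_mn j)) = col S j.
Proof.
move=> le_p.
have le_mn : (m <= n)%N.
  by rewrite -(sum_profile1 S) -(sum_profile1 S'); apply: leq_sum.
exists le_mn.
pose u := [seq col S j | j <- enum 'I_m] ++
  flatten [seq nseq (profile S' A - profile S A) A | A <- enum {set 'I_c}].
have pu : perm_eq [seq col S' j | j <- enum 'I_n] u.
  apply/allP => A _ /=; rewrite count_cat !count_col count_mem_flatten_nseq.
  by rewrite subnKC.
have szu : size u == n by rewrite -(perm_size pu) size_map size_enum_ord.
have /tuple_permP[p pE] : perm_eq [seq col S' j | j <- enum 'I_n] (Tuple szu) by [].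
exists (p^-1)%g => j; set j' := (p^-1)%g _.
have := congr1 (fun s => nth set0 s j') pE.
rewrite (nth_map j') ?size_enum_ord // nth_ord_enum => ->.
rewrite -tnth_nth tnth_mktuple permKV (tnth_nth set0) /= nth_cat.
by rewrite size_map size_enum_ord ltn_ord (nth_map j) ?size_enum_ord // nth_ord_enum.
Qed.

(** * Column maps acting on squarefree monomials *)

Section Action.
Variable k : fieldType.

Lemma subst_colsX m n (phi : 'I_m -> 'I_n) (u : 'X_{1..c * m}) (v : 'X_{1..c * n}) :
    injective phi ->
    (forall i j, v (mxvec_index i (phi j)) = u (mxvec_index i j)) ->
    (forall i j, j \notin codom phi -> v (mxvec_index i j) = 0%N) ->
  subst_cols (k := k) phi 'X_[u] = 'X_[v].
Proof.
move=> inj_phi vphi v0.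
rewrite /subst_cols comp_mpolyX [RHS]mpolyXE_id.
rewrite big_mxvec [RHS]big_mxvec.
apply: eq_bigr => i _.
rewrite [RHS](bigID (mem (codom phi))) /= [X in _ * X]big1 => [|j /v0 ->]; last first.
  by rewrite expr0.
rewrite mulr1 [RHS](eq_bigl (mem (phi @: setT))); last first.
  by move=> j; rewrite /=; apply/codomP/imsetP => [[x ->]|[x _ ->]]; exists x.
rewrite big_imset /=; last by move=> ? ? _ _; apply: inj_phi.
rewrite [RHS]big_mkcond; apply: eq_bigr => j _.
by rewrite inE tnth_mktuple mxvecE mxE vphi.
Qed.

Lemma sym_actX n (s : 'S_n) (S S' : {set 'I_(c * n)}) :
  (forall j, col S' (s j) = col S j) ->
  sym_act (k := k) s 'X_[sfmon S] = 'X_[sfmon S'].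
Proof.
move=> e; apply: subst_colsX => [|i j|i j]; first exact: perm_inj.
  by have /setP/(_ i) := e j; rewrite !inE !mnmE => ->.
by case/negP; rewrite -[j](permKV s) codom_f.
Qed.

Lemma inclX m n (le_mn : (m <= n)%N) (S : {set 'I_(c * m)}) :
  exists2 S' : {set 'I_(c * n)}, incl (k := k) le_mn 'X_[sfmon S] = 'X_[sfmon S'] &
    forall j, col S' j = set0 \/
              exists2 j0, j = widen_ord le_mn j0 & col S' j = col S j0.
Proof.
pose t (j : 'I_n) := if insub (j : nat) is Some j0 then col S j0 else set0.
exists (of_cols t) => [|j]; last first.
  rewrite col_of_cols /t; case: insubP => [j0 _ e|]; last by left.
  by right; exists j0 => //; apply: val_inj.
apply: subst_colsX => [j j' /(congr1 val) /= /val_inj //|i j|i j jn].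
  have /setP/(_ i) := col_of_cols t (widen_ord le_mn j).
  by rewrite /t /= valK inE [in RHS]inE !mnmE => ->.
have /setP/(_ i) := col_of_cols t j.
rewrite inE mnmE => ->; rewrite /t; case: insubP => [j0 _ e|]; last by rewrite inE.
by case/negP: jn; apply/codomP; exists j0; apply: val_inj.
Qed.

Lemma mpolyX_inj N : injective (fun m : 'X_{1..N} => 'X_[m] : {mpoly k[N]}).
Proof.
move=> m m' /= e; have := msuppX k m; rewrite e msuppX => h.
by have := mem_head m [::]; rewrite -h inE => /eqP.
Qed.

(** Permuting columns preserves the profile; conversely, [embed_cols] at equal sizes matches the
    columns of two sets with the same profile. *)
Lemma sym_orbit_sfmonC n (S : {set 'I_(c * n)}) m :
  sym_orbit k (sfmon (~: S)) m <->
  exists2 S', profile S' = profile S & m = sfmon (~: S').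
Proof.
split=> [[s]|[S' pS ->]].
  pose S' := of_cols (fun j => col S (s^-1%g j)).
  rewrite (@sym_actX _ s (~: S) (~: S')) => [/mpolyX_inj <-|j]; last first.
    by rewrite !colC col_of_cols permK.
  exists S' => //; apply/ffunP => A; rewrite !ffunE (reindex_inj (@perm_inj _ s)).
  by apply: eq_bigr => j _; rewrite col_of_cols permK.
have [|le_nn [s sP]] := @embed_cols n n S S'; first by move=> A; rewrite pS.
exists s; apply: sym_actX => j; rewrite !colC -sP; congr (~: col _ (s _)).
exact: val_inj.
Qed.

(** * Profiles of nonfaces and facets along a chain *)

Section Chain.
Variable I : forall n, {mpoly k[c * n]} -> Prop.
Hypothesis chainI : sym_invariant_chain I.
Hypothesis sqI : forall n, (0 < n)%N -> squarefree_monomial_ideal (@I n).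

(** Allowing a nonface at any level [m] removes the dependence on [n], and domination makes the
    property upward closed. *)
Definition nonface_profile (a : {ffun {set 'I_c} -> nat}) : Prop :=
  exists m (S : {set 'I_(c * m)}),
    [/\ (0 < m)%N, nonface (@I m) S & forall A, (profile S A <= a A)%N].

Definition facet_profile (a : {ffun {set 'I_c} -> nat}) : Prop :=
  ~ nonface_profile a /\
  forall A i, (0 < a A)%N -> i \notin A -> nonface_profile (enlarge a A i).

(** A nonface [T] whose profile is dominated is carried into [n] columns by inclusion and a
    permutation from [embed_cols]. The chain condition keeps it a nonface, and it lies in [S], its
    columns being empty or matched with those of [S]. *)
Lemma nonfaceP n (S : {set 'I_(c * n)}) : (0 < n)%N ->
  nonface (@I n) S <-> nonface_profile (profile S).
Proof.
move=> n0; split=> [nS|[m [T [m0 nT le_TS]]]]; first by exists n, S.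
have [le_mn [s sP]] := embed_cols le_TS.
have [_ symI] := chainI; have := symI m n le_mn _ s m0 nT.
have [T' -> colT'] := inclX le_mn T.
rewrite (@sym_actX _ s T' (of_cols (fun j => col T' (s^-1%g j)))); last first.
  by move=> j; rewrite col_of_cols permK.
apply: nonface_sub; first exact: squarefree_ideal_is_ideal (sqI n0).
apply/subsetP => l; case/mxvec_indexP: l => i j.
set T'' := of_cols _ => h; have : i \in col T'' j by rewrite inE.
rewrite col_of_cols; case: (colT' (s^-1%g j)) => [->|[j0 e ->]]; first by rewrite inE.
by rewrite -sP -e permKV inE.
Qed.

Lemma facetP n (S : {set 'I_(c * n)}) : (0 < n)%N ->
  facet (@I n) S <-> facet_profile (profile S).
Proof.
move=> n0; rewrite /facet /facet_profile nonfaceP //; split=> -[nS maxS]; split=> //.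
  move=> A i; rewrite ffunE lt0n sum_nat_eq0 negb_forall => /existsP[j].
  rewrite /= eqb0 negbK => /eqP <- ij.
  rewrite -profile_setU1 //; apply/nonfaceP => //; apply: maxS.
  by rewrite inE in ij.
move=> l; case/mxvec_indexP: l => i j ij; apply/nonfaceP => //.
have ij' : i \notin col S j by rewrite inE.
rewrite profile_setU1 //; apply: maxS => //.
by rewrite ffunE (bigD1 j) //= eqxx.
Qed.

End Chain.
End Action.
End Columns.

(** * Counting orbits by profiles *)

Section Orbits.
Variables (c : nat) (k : fieldType).

(** Orbits correspond to profiles by [sym_orbit_sfmonC], and every vector of sum [n] is a profile by
    [profile_surj]; one representative is chosen for each vector satisfying [P]. *)
Lemma orbit_count_num_comp n (M : 'X_{1..c * n} -> Prop)
    (P : pred {ffun {set 'I_c} -> nat}) :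
  (forall m, M m <-> exists2 S : {set 'I_(c * n)}, P (profile S) & m = sfmon (~: S)) ->
  orbit_count k M (num_comp n P).
Proof.
move=> MP; rewrite /num_comp; set X := [set _ | _].
have repr (b : 'I_#|X|) : exists S : {set 'I_(c * n)},
    profile S = [ffun A => enum_val b A : nat].
  apply: profile_surj; have := enum_valP b; rewrite inE => /andP[/eqP vn _].
  by rewrite -[RHS]vn; apply: eq_bigr => A _; rewrite ffunE.
have [T TP] := choice repr; exists (fun b => sfmon (~: T b)); split=> [b b'|m].
  move/sym_orbit_sfmonC => [S' pS'] /(congr1 (@msupport _)); rewrite !msupport_sfmon.
  move/setC_inj => e; apply/enum_val_inj/ffunP => A; apply: val_inj => /=.
  by have /ffunP/(_ A) := pS'; rewrite -e !TP !ffunE.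
rewrite MP; split=> [[S PS ->]|[b /sym_orbit_sfmonC[S pS ->]]]; last first.
  by exists S => //; rewrite pS TP; have := enum_valP b; rewrite inE => /andP[].
have ltn A : (profile S A < n.+1)%N.
  by rewrite ltnS -[X in (_ <= X)%N](sum_profile1 S) (bigD1 A) //= leq_addr.
pose v : {ffun {set 'I_c} -> 'I_n.+1} := [ffun A => Ordinal (ltn A)].
have vE : [ffun A => v A : nat] = profile S by apply/ffunP => A; rewrite !ffunE.
have Xv : v \in X.
  rewrite inE vE PS andbT -[X in _ == X](sum_profile1 S).
  by apply/eqP/eq_bigr => A _; rewrite ffunE.
exists (enum_rank_in Xv v); apply/sym_orbit_sfmonC; exists S => //.
by rewrite TP enum_rankK_in // vE.
Qed.

Variable I : forall n, {mpoly k[c * n]} -> Prop.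

Lemma nonface_profile_upclosed : upclosed (nonface_profile I).
Proof.
move=> a b [m [S [m0 nS le_Sa]]] le_ab; exists m, S; split=> // A.
exact: leq_trans (le_Sa A) (le_ab A).
Qed.

(* C is one more than the Dickson bound, since [enlarge] lowers a column count
   by one. *)
Lemma facet_profile_trunc :
  exists C, trunc_invariant C (fun a => `[< facet_profile I a >]).
Proof.
have [B UB] := upclosed_trunc nonface_profile_upclosed.
exists B.+1 => a; apply/asbool_equiv_eq.
have U_eq a1 a2 : trunc B a1 = trunc B a2 -> nonface_profile I a1 <-> nonface_profile I a2.
  by move=> e; rewrite -UB e UB.
have Ua : nonface_profile I (trunc B.+1 a) <-> nonface_profile I a.
  by apply: U_eq; apply/ffunP => A; rewrite !ffunE; lia.
have Ue A i : nonface_profile I (enlarge (trunc B.+1 a) A i) <->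
              nonface_profile I (enlarge a A i).
  apply: U_eq; apply/ffunP => A'; rewrite !ffunE.
  by have [?|?] := eqVneq A A'; have [?|?] := eqVneq (i |: A) A' => /=; lia.
have pos A : (0 < trunc B.+1 a A)%N = (0 < a A)%N by rewrite ffunE; lia.
rewrite /facet_profile Ua; split=> -[na max_a]; split=> // A i aA iA.
  by apply/Ue/max_a; rewrite ?pos.
by apply/Ue/max_a; rewrite -?pos.
Qed.

End Orbits.

Theorem theorem1p2 (c : nat) (k : fieldType)
    (I : forall n : nat, {mpoly k[c * n]} -> Prop) :
  (0 < c)%N ->
  sym_invariant_chain I ->
  (forall n : nat, (0 < n)%N -> squarefree_monomial_ideal (I n)) ->
  (exists (p : {poly rat}) (n0 : nat), forall n : nat, (n0 <= n)%N ->
     exists2 r : nat,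
       orbit_count k (minimal_generator (alexander_dual (I n))) r
       & r%:R = p.[n%:R]) /\
  (exists (a b : int) (q : {poly rat}) (n0 : nat), forall n : nat, (n0 <= n)%N ->
     (* the dual of the unit ideal is 0 and has no generators *)
     (~ I n 1 ->
        exists2 d : nat, least_generator_degree (alexander_dual (I n)) d
                         & d%:Z = a * n%:Z + b) /\
     (exists2 r : nat,
        orbit_count k (fun m => minimal_generator (alexander_dual (I n)) m /\
                                (mdeg m)%:Z = a * n%:Z + b) r
        & r%:R = q.[n%:R])).
Proof.
move=> _ chainI sqI.
have [C QC] := facet_profile_trunc I.
set Q := (fun a => _) in QC.
have genP n m : (0 < n)%N -> minimal_generator (alexander_dual (I n)) m <->
    exists2 S : {set 'I_(c * n)}, Q (profile S) & m = sfmon (~: S).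
  move=> n0; rewrite (dual_minimal_generator _ (sqI n n0)).
  split=> -[S fS ->]; exists S => //; first exact/asboolP/(facetP chainI sqI S n0).
  exact/(facetP chainI sqI S n0)/asboolP.
(* A column equal to [A] contributes the rows outside [A] to the complement, so this weight of the
   profile is the degree of the generator. *)
pose w (A : {set 'I_c}) := #|~: A|.
have wE n (S : {set 'I_(c * n)}) : mdeg (sfmon (~: S)) = weight w (profile S).
  by rewrite mdeg_sfmon card_setC_profile.
have degP n (d : int) : (0 < n)%N ->
    orbit_count k (fun m => minimal_generator (alexander_dual (I n)) m /\ (mdeg m)%:Z = d)
      (num_comp n (fun a => Q a && ((weight w a)%:Z == d))).
  move=> n0; apply: orbit_count_num_comp => m; rewrite genP //.
  split=> [[[S QS ->] dE]|[S /andP[QS /eqP dE] ->]].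
    by exists S => //; rewrite QS -wE dE eqxx.
  by rewrite wE; split=> //; exists S.
split.
  have [p [n0 pP]] := eventually_poly_trunc_invariant QC.
  (* The bound 1 avoids the index 0, where the chain is unconstrained. *)
  exists p, (maxn n0 1) => n; rewrite geq_max => /andP[le0 le1].
  exists (num_comp n Q); last exact: pP.
  by apply: orbit_count_num_comp => m; apply: genP.
have [[n0 noQ]|[[a b] [n0 [exQ leQ [q [n1 qP]]]]]] := least_weight w QC.
  (* Eventually there are no facets, so [I n] is the unit ideal: the claim on the least degree is
     vacuous, and any line with the zero polynomial serves. *)
  exists 0, 0, 0, (maxn n0 1) => n; rewrite geq_max => /andP[le0 le1]; split.
    move/(facet_exists (squarefree_ideal_is_ideal (sqI n le1))) => [S fS].
    have := noQ n (profile S) le0 (sum_profile1 S); case/negP.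
    exact/asboolP/(facetP chainI sqI S le1).
  exists (num_comp n (fun a => Q a && ((weight w a)%:Z == 0 * n%:Z + 0))).
    exact: degP.
  rewrite horner0 (_ : num_comp _ _ = 0%N) //; apply/eqP; rewrite cards_eq0 -subset0.
  apply/subsetP => v; rewrite inE => /andP[/eqP vn /andP[Qv _]].
  suff /(noQ n _ le0)/negP : (\sum_A [ffun A => v A : nat] A = n)%N by [].
  by rewrite -[RHS]vn; apply: eq_bigr => A _; rewrite ffunE.
exists a, b, q, (maxn (maxn n0 n1) 1) => n; rewrite !geq_max => /andP[/andP[le0 le1] le2].
split=> [_|]; last by eexists; [exact: degP|exact: qP].
have [v [vn Qv wv]] := exQ n le0.
exists (weight w v) => //; split=> [|m].
  have [S pS] := profile_surj vn; exists (sfmon (~: S)); last by rewrite wE pS.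
  by apply/genP => //; exists S => //; rewrite pS.
move/(genP _ _ le2) => [S QS ->]; rewrite wE -lez_nat wv.
exact: leQ (sum_profile1 S) QS.
Qed.
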